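(* Let $A$ be a finite-dimensional algebra over a field. The map $M\mapsto \mathrm{Gen}\,M$ is a bijection from the set of isomorphism classes of basic $\mathrm{Gen}$-minimal $A$-modules to the set of functorially finite quotient-closed subcategories of $\mathrm{mod}\,A$. The inverse map sends a subcategory $\mathcal C$ to the direct sum of the indecomposable splitting projective modules in $\mathcal C$ (one from each isomorphism class).
   Context: Modules are finitely generated right modules. All subcategories are full, additive, and closed under isomorphisms and direct summands. A subcategory is quotient-closed if it is closed under factor modules. For a module $M$, $\mathrm{add}\,M$ is the subcategory of direct summands of finite direct sums of copies of $M$, and $\mathrm{Gen}\,M$ is the subcategory of factor modules of finite direct sums of copies of $M$. A module is basic if its indecomposable direct summands in a decomposition into indecomposables are pairwise nonisomorphic (the zero module is included). A basic module $M$ is $\mathrm{Gen}$-minimal if $X\notin \mathrm{Gen}\,M'$ for every decomposition $M=X\oplus M'$ with $X$ indecomposable. An indecomposable module $X\in\mathcal C$ is splitting projective in $\mathcal C$ if every surjection $C\twoheadrightarrow X$ with $C\in\mathcal C$ splits. A morphism $C_X\to X$ with $C_X\in\mathcal C$ is a right $\mathcal C$-approximation of $X$ if every morphism from an object of $\mathcal C$ to $X$ factors through it; $\mathcal C$ is contravariantly finite if every module has a right $\mathcal C$-approximation. Left approximations and covariantly finite subcategories are defined dually, and $\mathcal C$ is functorially finite if it is both contravariantly and covariantly finite. *)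

(* Defs.v *)
From mathcomp Require Import all_boot all_algebra all_field.

Set Implicit Arguments.
Unset Strict Implicit.
Unset Printing Implicit Defensive.

Import GRing.Theory.
Local Open Scope ring_scope.

Definition finitely_generated (R : pzRingType) (M : lmodType R) : Prop :=
  exists (n : nat) (e : 'I_n -> M),
    forall x : M, exists c : 'I_n -> R, x = \sum_(i < n) c i *: e i.

Definition oppring (A : pzRingType) : pzRingType :=
  GRing.PzRing.clone A^c%type _.

(* Right A-modules are left modules over the opposite ring, so that a *: x
   stands for x.a; this is the object class of mod A. *)
Record fgmod (A : pzRingType) := FGMod {
  fgmod_car :> lmodType (oppring A);
  fgmod_fg : finitely_generated fgmod_car
}.

Section Modules.

Variable A : pzRingType.
Implicit Types M N X Y : fgmod A.

Lemma zero_fg : finitely_generated ('rV[oppring A]_0 : lmodType (oppring A)).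
Proof.
exists 0%N, (fun=> 0) => x.
by exists (fun=> 0); rewrite big_ord0; apply/rowP; case.
Qed.

Definition zero_mod : fgmod A := FGMod zero_fg.

Lemma prod_fg M N : finitely_generated ((M * N)%type : lmodType (oppring A)).
Proof.
have [m [e eP]] := fgmod_fg M; have [n [f fP]] := fgmod_fg N.
exists (m + n)%N, (fun i => match split i with
                            | inl j => (e j, 0)
                            | inr j => (0, f j)
                            end).
move=> [x y]; have [c ->] := eP x; have [d ->] := fP y.
exists (fun i => match split i with inl j => c j | inr j => d j end).
rewrite big_split_ord /=.
under [X in _ = X + _]eq_bigr => i _ do rewrite (unsplitK (inl i)).
under [X in _ = _ + X]eq_bigr => i _ do rewrite (unsplitK (inr i)).
rewrite [RHS]surjective_pairing !raddfD !raddf_sum /=.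
congr pair; last by rewrite [X in X + _]big1 ?add0r // => i _; rewrite scaler0.
by rewrite [X in _ + X]big1 ?addr0 // => i _; rewrite scaler0.
Qed.

Definition dsum M N : fgmod A := FGMod (prod_fg M N).

Definition dsum_fam (n : nat) (X : 'I_n -> fgmod A) : fgmod A :=
  \big[dsum/zero_mod]_(i < n) X i.

Definition iso M N : Prop := exists f : {linear M -> N}, bijective f.

Definition surjection M N (f : {linear M -> N}) : Prop :=
  forall y : N, exists x : M, f x = y.

Definition is_zero M : Prop := forall x : M, x = 0.

Definition indecomposable M : Prop :=
  ~ is_zero M /\
  forall X Y, iso M (dsum X Y) -> is_zero X \/ is_zero Y.

Definition pairwise_noniso (n : nat) (X : 'I_n -> fgmod A) : Prop :=
  forall i j : 'I_n, i <> j -> ~ iso (X i) (X j).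

Definition basic M : Prop :=
  exists (n : nat) (X : 'I_n -> fgmod A),
    [/\ forall i, indecomposable (X i), pairwise_noniso X
      & iso M (dsum_fam X)].

(* A full subcategory of mod A is given by its class of objects. *)
Definition Gen M : fgmod A -> Prop :=
  fun N => exists (n : nat) (f : {linear dsum_fam (fun _ : 'I_n => M) -> N}),
    surjection f.

Definition Gen_minimal M : Prop :=
  basic M /\
  forall X M', iso M (dsum X M') -> indecomposable X -> ~ Gen M' X.

Implicit Types C D : fgmod A -> Prop.

Definition same_subcat C D : Prop := forall M, C M <-> D M.

(* The zero object, as an empty direct sum, belongs to every subcategory. *)
Record subcategory C : Prop := Subcategory {
  subcat_iso : forall M N, iso M N -> C M -> C N;
  subcat_zero : C zero_mod;
  subcat_dsum : forall M N, C M -> C N -> C (dsum M N);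
  subcat_summand : forall M N, C (dsum M N) -> C M
}.

Definition quotient_closed C : Prop :=
  forall M N (f : {linear M -> N}), surjection f -> C M -> C N.

Definition right_approx C X (CX : fgmod A) (f : {linear CX -> X}) : Prop :=
  C CX /\
  forall Y (g : {linear Y -> X}), C Y ->
    exists h : {linear Y -> CX}, forall y, g y = f (h y).

Definition left_approx C X (CX : fgmod A) (f : {linear X -> CX}) : Prop :=
  C CX /\
  forall Y (g : {linear X -> Y}), C Y ->
    exists h : {linear CX -> Y}, forall x, g x = h (f x).

Definition contravariantly_finite C : Prop :=
  forall X, exists (CX : fgmod A) (f : {linear CX -> X}), right_approx C f.

Definition covariantly_finite C : Prop :=
  forall X, exists (CX : fgmod A) (f : {linear X -> CX}), left_approx C f.

Definition functorially_finite C : Prop :=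
  contravariantly_finite C /\ covariantly_finite C.

Definition ff_quotient_closed_subcat C : Prop :=
  [/\ subcategory C, functorially_finite C & quotient_closed C].

Definition splitting_projective C X : Prop :=
  [/\ indecomposable X, C X
    & forall Y (f : {linear Y -> X}), C Y -> surjection f ->
        exists g : {linear X -> Y}, forall x, f (g x) = x].

(* P is the direct sum of a finite, complete and irredundant list of
   representatives of the isomorphism classes of splitting projectives. *)
Definition splitting_projective_sum C P : Prop :=
  exists (n : nat) (X : 'I_n -> fgmod A),
    [/\ forall i, splitting_projective C (X i), pairwise_noniso X,
        forall Y, splitting_projective C Y -> exists i, iso Y (X i)
      & iso P (dsum_fam X)].

End Modules.

(* Main.v *)
Require Import Defs.
From mathcomp Require Import all_boot all_algebra all_field.
From mathcomp Require Import boolp.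
From HB Require Import structures.

(**
The trace of M in N is the sum of the images of all morphisms M -> N.  As
N is finitely generated, N lies in Gen M exactly when this trace is all of N;
working with elements of traces makes the closure properties of Gen M formal.

Gen M is functorially finite for every M.  The inclusion of the trace of M in X
is a right approximation of X.  For a left approximation, let x_1, ..., x_n
generate X and let m_1, ..., m_d be a basis of M over the base field.  In the sum
of n * d copies of M put u_i, which has m_j as its component (i, j) for each j.  If g
is a morphism from X to a module of Gen M, then g x_i is a sum over j of images of
the m_j, so some morphism from the sum of copies sends every u_i to g x_i.  Hence
dividing the sum of copies by the relations sum a_i u_i for which sum a_i x_i = 0
gives the target of a left approximation x_i |-> u_i.

Conversely, if C is quotient-closed and covariantly finite, every module of C is
generated by the left approximation N of the regular module, so C = Gen N.  A module M
of smallest dimension with Gen M = Gen N is Gen-minimal: a summand generated by its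
complement could be discarded, and two isomorphic summands generate one another.

It remains to see that a Gen-minimal M is the sum of the indecomposable splitting
projectives of Gen M; this gives injectivity and the inverse map, because a sum of
representatives of the splitting projectives is unique up to isomorphism
(splitting_projective_sum_iso).  Both halves rest on the endomorphism ring of
an indecomposable module being local (local_end), a consequence of Fitting's lemma.

If X is an indecomposable summand of M with complement M', and if a surjection
f : Y -> X with Y in Gen M does not split, then no f o h with h : X -> Y is
bijective.  As X and M' generate Y, the module X is the sum of the trace of M' and of
images of non-invertible endomorphisms of X.  Nakayama's lemma over End X then makes
X the trace of M', against minimality.

If Y is splitting projective in Gen M, a surjection from a power of M onto Y splits,
so the identity of Y is a sum of endomorphisms factoring through indecomposable
summands of M.  One of them is invertible by locality, and Y is isomorphic to the
summand through which it factors.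
*)

Set Implicit Arguments.
Unset Strict Implicit.
Unset Printing Implicit Defensive.

Import GRing.Theory.

Local Open Scope ring_scope.

(** * Linear maps *)

Section LinearMaps.

Variable R : pzRingType.
Implicit Types M N : lmodType R.

Definition Lin M N (f : M -> N) (f_lin : linear f) : {linear M -> N} :=
  HB.pack f (GRing.isLinear.Build R M N *:%R f f_lin).

Fact lin_sum_subproof M N (I : Type) (r : seq I) (f : I -> {linear M -> N}) :
  linear (fun x => \sum_(i <- r) f i x).
Proof.
move=> a x y; rewrite scaler_sumr -big_split /=.
by apply: eq_bigr => i _; rewrite linearP.
Qed.

Definition lin_sum M N (I : finType) (f : I -> {linear M -> N}) :=
  Lin (lin_sum_subproof (index_enum I) f).

Lemma linear_inverse M N (f : {linear M -> N}) :
  bijective f -> exists g : {linear N -> M}, cancel f g /\ cancel g f.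
Proof.
case=> g fK gK.
have g_lin : linear g by move=> a x y; apply: (can_inj fK); rewrite linearP !gK.
by exists (Lin g_lin).
Qed.

End LinearMaps.

(** * Direct sums and generation over an arbitrary ring *)

Section GeneralRing.

Variable A : pzRingType.
Implicit Types (M N S T X Y P Q : fgmod A) (C D : fgmod A -> Prop).

Lemma iso_refl M : iso M M.
Proof. by exists idfun; exists idfun. Qed.

Lemma iso_sym M N : iso M N -> iso N M.
Proof. by case=> f /linear_inverse [g [fK gK]]; exists g; exists f. Qed.

Lemma iso_trans M N X : iso M N -> iso N X -> iso M X.
Proof. by move=> [f bf] [g bg]; exists (g \o f); apply: bij_comp. Qed.

Lemma iso_is_zero M N : iso M N -> is_zero M -> is_zero N.
Proof. by case=> f [g fK gK] M0 x; rewrite -(gK x) (M0 (g x)) linear0. Qed.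

Fact dsum_inl_subproof M N : linear (fun x => (x, 0) : dsum M N).
Proof. by move=> a x y; congr pair; rewrite /= scaler0 addr0. Qed.

Fact dsum_inr_subproof M N : linear (fun y => (0, y) : dsum M N).
Proof. by move=> a x y; congr pair; rewrite /= scaler0 addr0. Qed.

Definition dsum_inl M N : {linear M -> dsum M N} :=
  Lin (@dsum_inl_subproof M N).
Definition dsum_inr M N : {linear N -> dsum M N} :=
  Lin (@dsum_inr_subproof M N).
Definition dsum_fst M N : {linear dsum M N -> M} := fst.
Definition dsum_snd M N : {linear dsum M N -> N} := snd.

Lemma dsum_split M N (z : dsum M N) :
  z = dsum_inl M N (dsum_fst M N z) + dsum_inr M N (dsum_snd M N z).
Proof. by case: z => x y; congr pair; rewrite /= ?addr0 ?add0r. Qed.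

(** Biproduct data with an arbitrary finite index type: unlike an iterated binary sum,
    it can be reindexed and concatenated without rebracketing. *)
Definition is_dsum (I : finType) (X : I -> fgmod A) S : Prop :=
  exists (inj : forall i, {linear X i -> S}) (pr : forall i, {linear S -> X i}),
    [/\ forall i, cancel (inj i) (pr i),
        forall i j x, i != j -> pr j (inj i x) = 0
      & forall s, s = \sum_i inj i (pr i s)].

Lemma dsum_coord (I : finType) (X : I -> fgmod A) S
    (inj : forall i, {linear X i -> S}) (pr : forall i, {linear S -> X i}) :
    (forall i, cancel (inj i) (pr i)) ->
    (forall i j x, i != j -> pr j (inj i x) = 0) ->
  forall (x : forall i, X i) i, pr i (\sum_j inj j (x j)) = x i.
Proof.
move=> pK p0 x i; rewrite linear_sum (bigD1 i) //= pK big1 ?addr0 // => j ji.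
exact: p0.
Qed.

Lemma is_dsum_isoS (I : finType) (X : I -> fgmod A) S T :
  iso S T -> is_dsum X S -> is_dsum X T.
Proof.
case=> f /linear_inverse [g [fK gK]] [inj [pr [pK p0 sE]]].
exists (fun i => f \o inj i), (fun i => pr i \o g); split=> [i x|i j x ij|s] /=.
- by rewrite fK pK.
- by rewrite fK p0.
- by rewrite -raddf_sum -(sE (g s)); exact: (esym (gK s)).
Qed.

Lemma is_dsum_unique (I : finType) (X Y : I -> fgmod A) S T :
  (forall i, iso (X i) (Y i)) -> is_dsum X S -> is_dsum Y T -> iso S T.
Proof.
move=> XY [inj [pr [pK p0 sE]]] [inj' [pr' [pK' p0' sE']]].
have fgP i : exists fg : {linear X i -> Y i} * {linear Y i -> X i},
    cancel fg.1 fg.2 /\ cancel fg.2 fg.1.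
  by have [f /linear_inverse [g gP]] := XY i; exists (f, g).
pose f i := (sval (cid (fgP i))).1; pose g i := (sval (cid (fgP i))).2.
have fK i : cancel (f i) (g i) by have [] := svalP (cid (fgP i)).
have gK i : cancel (g i) (f i) by have [] := svalP (cid (fgP i)).
exists (lin_sum (fun i => inj' i \o (f i \o pr i))).
exists (lin_sum (fun i => inj i \o (g i \o pr' i))) => s /=.
  rewrite [RHS]sE; apply: eq_bigr => i _.
  by rewrite (dsum_coord pK' p0' (fun j => f j (pr j s))) fK.
rewrite [RHS]sE'; apply: eq_bigr => i _.
by rewrite (dsum_coord pK p0 (fun j => g j (pr' j s))) gK.
Qed.

Lemma is_dsum_sum (I J : finType) (X : I + J -> fgmod A) S T :
  is_dsum (X \o inl) S -> is_dsum (X \o inr) T -> is_dsum X (dsum S T).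
Proof.
move=> [inj [pr [pK p0 sE]]] [inj' [pr' [pK' p0' sE']]].
pose jn k : {linear X k -> dsum S T} := match k with
  | inl i => dsum_inl S T \o inj i | inr j => dsum_inr S T \o inj' j end.
pose q k : {linear dsum S T -> X k} := match k with
  | inl i => pr i \o dsum_fst S T | inr j => pr' j \o dsum_snd S T end.
exists jn, q; split=> [[i|j] x|[i|j] [k|l] x ij|s] /=.
- exact: pK.
- exact: pK'.
- exact: p0.
- exact: linear0.
- exact: linear0.
- exact: p0'.
rewrite big_sumType /= {1}[s]dsum_split {1}[dsum_fst _ _ s]sE.
by rewrite {1}[dsum_snd _ _ s]sE' !linear_sum.
Qed.

Lemma is_dsum_reindex (I J : finType) (h : J -> I) (X : I -> fgmod A) S :
  bijective h -> is_dsum (X \o h) S <-> is_dsum X S.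
Proof.
have imp (I' J' : finType) (k : J' -> I') (Y : I' -> fgmod A) :
    bijective k -> is_dsum Y S -> is_dsum (Y \o k) S.
  move=> bk [inj [pr [pK p0 sE]]].
  exists (fun j => inj (k j)), (fun j => pr (k j)); split=> [j|i j x ij|s] /=.
  - exact: pK.
  - by apply: p0; rewrite (inj_eq (bij_inj bk)).
  by rewrite {1}[s]sE (reindex k) //; apply: onW_bij.
(* The converse is the same implication for the inverse bijection. *)
move=> bh; split; last exact: imp.
have [h' hK h'K] := bh.
have /(imp _ _ _ (X \o h)) H : bijective h' by exists h.
by move=> /H; suff -> : (X \o h) \o h' = X by []; apply/funext => i /=; rewrite h'K.
Qed.

Lemma is_dsum1 M : is_dsum (fun _ : unit => M) M.
Proof.
exists (fun=> idfun), (fun=> idfun); split=> [[]|[] []|s] //=.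
by rewrite (big_pred1 tt) //; case.
Qed.

Lemma is_dsum0 (I : finType) (X : I -> fgmod A) M :
  #|I| = 0%N -> is_zero M -> is_dsum X M.
Proof.
move=> /card0_eq I0 M0; exists (fun i => \0), (fun i => \0).
split=> [i|i|s]; try by have := I0 i.
by rewrite [LHS]M0 [RHS]M0.
Qed.

Lemma zero_mod_is_zero : is_zero (zero_mod A).
Proof. by move=> x; apply/rowP; case. Qed.

Lemma is_dsum_fam n (X : 'I_n -> fgmod A) : is_dsum X (dsum_fam X).
Proof.
elim: n X => [|n IHn] X.
  by rewrite /dsum_fam big_ord0; apply: is_dsum0 zero_mod_is_zero; rewrite card_ord.
rewrite /dsum_fam big_ord_recl.
pose h (k : unit + 'I_n) := if k is inr i then lift ord0 i else ord0.
have bh : bijective h.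
  exists (fun i => if unlift ord0 i is Some j then inr j else inl tt).
    by case=> [[]|i] /=; rewrite ?unlift_none ?liftK.
  by move=> i; case: unliftP => [j|] ->.
apply/(is_dsum_reindex _ _ bh)/is_dsum_sum; first exact: (is_dsum1 (X ord0)).
exact: IHn.
Qed.

Lemma dsum_exists (I : finType) (X : I -> fgmod A) : exists S, is_dsum X S.
Proof.
exists (dsum_fam (X \o @enum_val I I)).
exact/(is_dsum_reindex _ _ (enum_val_bij I))/is_dsum_fam.
Qed.

Lemma iso_dsum_famP n (X : 'I_n -> fgmod A) S :
  iso S (dsum_fam X) <-> is_dsum X S.
Proof.
split=> [/iso_sym/is_dsum_isoS|XS]; first by apply; apply: is_dsum_fam.
by apply: is_dsum_unique XS (is_dsum_fam X) => i; apply: iso_refl.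
Qed.

(** The sum of the images of all morphisms M -> N, as a predicate on N. *)
Inductive in_trace M N : N -> Prop :=
  | trace_img (f : {linear M -> N}) x : in_trace M (f x)
  | trace_add y z : in_trace M y -> in_trace M z -> in_trace M (y + z).

Lemma trace0 M N : in_trace M (0 : N).
Proof. exact: (trace_img (\0 : {linear M -> N}) 0). Qed.

Lemma trace_scale M N a (y : N) : in_trace M y -> in_trace M (a *: y).
Proof.
elim=> [f x|y1 y2 _ IH1 _ IH2]; first by rewrite -linearZ; apply: trace_img.
by rewrite scalerDr; apply: trace_add.
Qed.

Lemma trace_sum M N (I : finType) (y : I -> N) :
  (forall i, in_trace M (y i)) -> in_trace M (\sum_i y i).
Proof.
by move=> yP; elim/big_ind: _ => // [|? ?]; [apply: trace0|apply: trace_add].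
Qed.

Lemma trace_map M N X (h : {linear N -> X}) y : in_trace M y -> in_trace M (h y).
Proof.
elim=> [f x|y1 y2 _ IH1 _ IH2]; first exact: (trace_img (h \o f)).
by rewrite linearD; apply: trace_add.
Qed.

Lemma trace_trans M N X : (forall y : N, in_trace M y) ->
  forall x : X, in_trace N x -> in_trace M x.
Proof.
move=> MN x; elim=> [f y|y1 y2 _ IH1 _ IH2]; first exact: trace_map.
exact: trace_add.
Qed.

Lemma trace_finite M N (y : N) : in_trace M y ->
  exists n (g : 'I_n -> {linear M -> N}) x, y = \sum_i g i (x i).
Proof.
elim=> [f x|_ _ _ [n [g [x ->]]] _ [n' [g' [x' ->]]]].
  by exists 1%N, (fun=> f), (fun=> x); rewrite big_ord1.
exists (n + n')%N, (fun i => match split i with inl j => g j | inr j => g' j end).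
exists (fun i => match split i with inl j => x j | inr j => x' j end).
rewrite big_split_ord /=; congr (_ + _); apply: eq_bigr => i _.
  by rewrite (unsplitK (inl i)).
by rewrite (unsplitK (inr i)).
Qed.

(** A surjection onto N from a power of M exists as soon as each of the finitely many
    generators of N lies in the trace: one copy of M is used for each morphism that
    occurs in writing a generator as a sum of images. *)
Lemma GenP M N : Gen M N <-> forall y : N, in_trace M y.
Proof.
split=> [[n [f fs]] y|MN].
  have [s <-] := fs y; have [inj [pr [_ _ sE]]] := is_dsum_fam (fun _ : 'I_n => M).
  rewrite [s]sE raddf_sum; apply: trace_sum => i.
  exact: (trace_img (f \o inj i)).
have [k [e eP]] := fgmod_fg N.
have /choice [d dP] j : exists d : {n & ('I_n -> {linear M -> N}) * ('I_n -> M)}%type,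
    e j = \sum_i (tagged d).1 i ((tagged d).2 i).
  by have [n [g [x ->]]] := trace_finite (MN (e j)); exists (existT _ n (g, x)).
pose I := {j : 'I_k & 'I_(tag (d j))}.
pose g (p : I) := (tagged (d (tag p))).1 (tagged p).
pose x (p : I) := (tagged (d (tag p))).2 (tagged p).
have [inj [pr [pK p0 sE]]] := is_dsum_fam (fun _ : 'I_#|{: I}| => M).
exists #|{: I}|, (lin_sum (fun p => g (enum_val p) \o pr p)) => y.
have [a ->] := eP y.
exists (\sum_p inj p (a (tag (enum_val p)) *: x (enum_val p))) => /=.
(* The sum over all pairs (generator, morphism occurring in its expression). *)
transitivity (\sum_(p : I) g p (a (tag p) *: x p)).
  rewrite (reindex _ (onW_bij _ (enum_val_bij I))) /=; apply: eq_bigr => p _.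
  by rewrite (dsum_coord pK p0).
rewrite (eq_bigr _ (fun j _ => congr1 ( *:%R (a j)) (dP j))).
under [RHS]eq_bigr => j _ do rewrite scaler_sumr.
rewrite sig_big_dep /=; apply: eq_bigr => p _; exact: linearZ.
Qed.

Lemma Gen_quotient_closed M : quotient_closed (Gen M).
Proof.
move=> N X f fs /GenP MN; apply/GenP => x; have [y <-] := fs x; exact: trace_map.
Qed.

Lemma Gen_refl M : Gen M M.
Proof. by apply/GenP => y; apply: (trace_img (idfun : {linear M -> M})). Qed.

Lemma Gen_trans M N X : Gen M N -> Gen N X -> Gen M X.
Proof. by move=> /GenP MN /GenP NX; apply/GenP => x; apply: trace_trans (NX x). Qed.

Lemma Gen_iso M N X : iso N X -> Gen M N -> Gen M X.
Proof.
by case=> f [g _ gK]; apply: (Gen_quotient_closed (f := f)) => y; exists (g y).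
Qed.

Lemma Gen_zero M N : is_zero N -> Gen M N.
Proof. by move=> N0; apply/GenP => y; rewrite [y]N0; apply: trace0. Qed.

Lemma Gen_dsum_of (I : finType) (X : I -> fgmod A) M S :
  is_dsum X S -> (forall i, Gen M (X i)) -> Gen M S.
Proof.
move=> [inj [pr [_ _ sE]]] MX; apply/GenP => s; rewrite [s]sE.
by apply: trace_sum => i; apply: trace_map; move: (pr i s); apply/GenP.
Qed.

Lemma Gen_dsum M X Y : Gen M X -> Gen M Y -> Gen M (dsum X Y).
Proof.
move=> /GenP MX /GenP MY; apply/GenP => z.
by rewrite [z]dsum_split; apply: trace_add; apply: trace_map.
Qed.

Lemma Gen_summand M X Y : Gen M (dsum X Y) -> Gen M X.
Proof.
by apply: (Gen_quotient_closed (f := dsum_fst X Y)) => x; exists (x, 0).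
Qed.

Lemma Gen_summandr M X Y : Gen M (dsum X Y) -> Gen M Y.
Proof.
by apply: (Gen_quotient_closed (f := dsum_snd X Y)) => x; exists (0, x).
Qed.

Lemma Gen_subcategory M : subcategory (Gen M).
Proof.
split; [by move=> N X /Gen_iso; apply|exact: Gen_zero zero_mod_is_zero|
        exact: Gen_dsum|exact: Gen_summand].
Qed.

Lemma same_Gen M N : Gen M N -> Gen N M -> same_subcat (Gen M) (Gen N).
Proof. by move=> MN NM X; split; apply: Gen_trans. Qed.

Lemma basic_iso M N : iso M N -> basic M -> basic N.
Proof.
move=> /iso_sym NM [n [X [Xind Xni MX]]]; exists n, X; split=> //.
exact: iso_trans MX.
Qed.

Lemma Gen_minimal_iso M N : iso M N -> Gen_minimal M -> Gen_minimal N.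
Proof.
move=> MN [bM mM]; split; first exact: basic_iso bM.
by move=> X M' /(iso_trans MN); apply: mM.
Qed.

Lemma Gen_iso_same M N : iso M N -> same_subcat (Gen M) (Gen N).
Proof.
move=> MN; apply: same_Gen; first exact: Gen_iso (Gen_refl M).
exact: Gen_iso (iso_sym MN) (Gen_refl N).
Qed.

Lemma splitting_projective_same C D X : same_subcat C D ->
  splitting_projective C X -> splitting_projective D X.
Proof.
move=> CD [Xind CX Xsp]; split=> // [|Y f /CD]; [exact/CD|exact: Xsp].
Qed.

Lemma splitting_projective_sum_same C D P : same_subcat C D ->
  splitting_projective_sum C P -> splitting_projective_sum D P.
Proof.
move=> CD [n [X [spX Xni Xall PX]]]; exists n, X; split=> //.
  by move=> i; apply: splitting_projective_same (spX i).
by move=> Y spY; apply/Xall/(splitting_projective_same _ spY) => M; split=> /CD.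
Qed.

(** Each list of representatives embeds in the other, so both have the same length and
    the matching is a bijection. *)
Lemma splitting_projective_sum_iso C P Q :
  splitting_projective_sum C P -> splitting_projective_sum C Q -> iso P Q.
Proof.
move=> [n [X [spX Xni Xall /iso_dsum_famP PX]]] [m [Y [spY Yni Yall /iso_dsum_famP QY]]].
have /choice [s sP] i : exists j, iso (X i) (Y j) by apply: Yall.
have /choice [t tP] j : exists i, iso (Y j) (X i) by apply: Xall.
have s_inj : injective s.
  move=> i i' sii; have [//|/eqP/Xni []] := eqVneq i i'.
  by apply: iso_trans (sP i) _; rewrite sii; apply: iso_sym.
have t_inj : injective t.
  move=> i i' sii; have [//|/eqP/Yni []] := eqVneq i i'.
  by apply: iso_trans (tP i) _; rewrite sii; apply: iso_sym.
have s_bij : bijective s by apply: inj_card_bij s_inj (leq_card t t_inj).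
by apply: (is_dsum_unique sP PX); apply/is_dsum_reindex.
Qed.

End GeneralRing.

(** * Finite-dimensional modules: dimension, submodules and quotients *)

Section FinDim.

Variables (F : fieldType) (A : falgType F).
Implicit Types M N : fgmod A.

(** The base field acts on a module through the scalars of A. *)
Definition base_scalar (c : F) : oppring A := (c%:A : A).

Lemma base_scalar_central c (a : oppring A) : base_scalar c * a = a * base_scalar c.
Proof.
rewrite /base_scalar; change ((a : A) * c%:A = c%:A * (a : A)).
by rewrite mulr_algl mulr_algr.
Qed.

Lemma base_scalarM c d : base_scalar c * base_scalar d = base_scalar (c * d).
Proof.
change ((d%:A : A) * c%:A = (c * d)%:A :> A).
by rewrite mulr_algl scalerA mulrC.
Qed.

(** The restriction of scalars of M to the base field; the alias carries the second
    module structure and, through a chosen basis, a dimension. *)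
Definition res M : Type := M.

HB.instance Definition _ M := GRing.Zmodule.on (res M).

Definition res_scale M (c : F) (x : res M) : res M := base_scalar c *: (x : M).

Fact res_scaleA M c d (x : res M) :
  res_scale c (res_scale d x) = res_scale (c * d) x.
Proof. by rewrite /res_scale scalerA base_scalarM. Qed.

Fact res_scale1 M : left_id 1 (@res_scale M).
Proof. by move=> x; rewrite /res_scale /base_scalar scale1r; apply: scale1r. Qed.

Fact res_scaleDr M : right_distributive (@res_scale M) +%R.
Proof. by move=> c x y; apply: scalerDr. Qed.

Fact res_scaleDl M (x : res M) : {morph (@res_scale M)^~ x : c d / c + d}.
Proof.
by move=> c d; rewrite /res_scale /base_scalar scalerDl; apply: scalerDl.
Qed.

HB.instance Definition _ M := GRing.Zmodule_isLmodule.Build F (res M)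
  (@res_scaleA M) (@res_scale1 M) (@res_scaleDr M) (@res_scaleDl M).

Lemma res_scaleE M (c : F) (x : res M) : c *: x = base_scalar c *: (x : M).
Proof. by []. Qed.

Lemma res_spanning M : exists n, `[< exists e : 'I_n -> res M,
  forall x, exists c : 'I_n -> F, x = \sum_i c i *: e i >].
Proof.
have [n [e eP]] := fgmod_fg M; set b := vbasis {:A}.
pose I := ('I_n * 'I_(\dim {:A}))%type.
pose be (p : I) : res M := (b`_p.2 : oppring A) *: e p.1.
exists #|{: I}|; apply/asboolP; exists (be \o enum_val) => x.
have [a ->] := eP x; pose c (p : I) := coord b p.2 (a p.1 : A).
exists (c \o enum_val).
transitivity (\sum_(p : I) c p *: be p); last first.
  by rewrite (reindex _ (onW_bij _ (enum_val_bij I))).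
rewrite -(pair_bigA _ (fun i j => coord b j (a i : A) *:
    ((b`_j : oppring A) *: e i : res M))) /=.
apply: eq_bigr => i _.
have aE : a i = \sum_(j < \dim {:A}) (coord b j (a i : A) *: (b`_j : A) : oppring A).
  exact: (coord_vbasis (memvf (a i : A))).
rewrite [in LHS]aE scaler_suml.
apply: eq_bigr => j _; rewrite /c /be /= res_scaleE scalerA.
have cb : (coord b j (a i : A) *: b`_j : A) =
    (base_scalar (coord b j (a i : A)) * b`_j : oppring A) :> oppring A.
  change (coord b j (a i : A) *: b`_j = b`_j * (coord b j (a i : A))%:A :> A).
  by rewrite mulr_algr.
exact: (congr1 (fun a : oppring A => a *: e i) cb).
Qed.

(** A spanning family of minimal size is independent: a vector with a nonzero
    coefficient in a relation could be dropped. *)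
Lemma res_basis M : exists n (e : 'I_n -> res M),
  bijective (fun c : 'rV[F]_n => \sum_i c 0 i *: e i).
Proof.
have [n /asboolP[e eP] n_min] := ex_minnP (res_spanning M); exists n, e.
suff inj_e (c : 'rV[F]_n) : \sum_i c 0 i *: e i = 0 -> c = 0.
  have eP' x : exists c : 'rV[F]_n, x == \sum_i c 0 i *: e i.
    have [c cP] := eP x; exists (\row_i c i); apply/eqP; rewrite {1}cP.
    by apply: eq_bigr => i _; rewrite mxE.
  exists (fun x => xchoose (eP' x)); last first.
    by move=> x /=; rewrite -(eqP (xchooseP (eP' x))).
  move=> c /=; set d := xchoose _; apply/eqP; rewrite -subr_eq0; apply/eqP/inj_e.
  under eq_bigr => i _ do rewrite !mxE scalerBl.
  by rewrite sumrB -(eqP (xchooseP (eP' _))) subrr.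
move=> c0; apply/rowP => i; rewrite mxE; apply/eqP/negPn/negP => ci0.
case: n => [|n] in e eP n_min c c0 i ci0 *; first by case: i ci0.
suff /n_min : `[< exists e : 'I_n -> res M,
    forall x, exists c : 'I_n -> F, x = \sum_i c i *: e i >] by rewrite ltnn.
have lift_sum (f : 'I_n.+1 -> res M) : \sum_j f j = f i + \sum_j f (lift i j).
  rewrite (bigD1_ord i) //.
apply/asboolP; exists (e \o lift i) => x.
have [d ->] := eP x.
have ei : e i = - \sum_j (c 0 (lift i j) / c 0 i) *: e (lift i j).
  move: c0; rewrite lift_sum => /eqP; rewrite addr_eq0 => /eqP c0.
  apply: (scalerI ci0); rewrite c0 scalerN scaler_sumr; congr (- _).
  by apply: eq_bigr => j _; rewrite scalerA mulrC divfK.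
exists (fun j => d (lift i j) - d i * (c 0 (lift i j) / c 0 i)).
rewrite lift_sum ei addrC scalerN scaler_sumr -sumrB; apply: eq_bigr => j _ /=.
by rewrite scalerBl scalerA.
Qed.

Fact res_vector M : {n & Vector.axiom n (res M)}.
Proof.
have [n /cid [e e_bij]] := cid (res_basis M); exists n.
have f_lin : linear (fun c : 'rV[F]_n => \sum_i c 0 i *: e i).
  move=> a c d; rewrite scaler_sumr -big_split; apply: eq_bigr => i _ /=.
  by rewrite !mxE scalerDl scalerA.
have [g [gK Kg]] := cid (@linear_inverse F _ _ (Lin f_lin) e_bij).
by exists g; [apply: linearP|exists (Lin f_lin)].
Qed.

HB.instance Definition _ M :=
  Lmodule_hasFinDim.Build F (res M) (projT2 (res_vector M)).

Fact res_map_subproof M N (f : {linear M -> N}) :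
  linear (f : res M -> res N).
Proof. by move=> c x y; rewrite !res_scaleE linearP. Qed.

Definition res_map M N (f : {linear M -> N}) : 'Hom(res M, res N) :=
  linfun (Lin (res_map_subproof f)).

Lemma res_mapE M N (f : {linear M -> N}) x : res_map f x = f x.
Proof. exact: lfunE. Qed.

Definition mdim M := \dim {: res M}.

Lemma res_map_inj M N (f : {linear M -> N}) :
  injective f -> lker (res_map f) == 0%VS.
Proof. by move=> f_inj; apply/lker0P => x y; rewrite !res_mapE => /f_inj. Qed.

Lemma res_map_limg M N (f : {linear M -> N}) :
  surjection f <-> limg (res_map f) = fullv.
Proof.
split=> [fs|ff y].
  apply/vspaceP => y; rewrite memvf; have [x <-] := fs y.
  by rewrite -res_mapE memv_img ?memvf.
have /memv_imgP [x _] : (y : res N) \in limg (res_map f) by rewrite ff memvf.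
by rewrite res_mapE; exists x.
Qed.

Lemma mdim_inj M N (f : {linear M -> N}) : injective f -> (mdim M <= mdim N)%N.
Proof.
move/res_map_inj/eqP => f0; have := limg_ker_dim (res_map f) fullv.
by rewrite f0 capv0 dimv0 add0n /mdim => <-; apply: dimvS; apply: subvf.
Qed.

Lemma mdim_inj_surj M N (f : {linear M -> N}) :
  injective f -> mdim N = mdim M -> surjection f.
Proof.
move/res_map_inj/eqP => f0 MN; apply/res_map_limg.
have /eqP -> : limg (res_map f) == fullv; last by [].
rewrite eqEdim subvf /=; have := limg_ker_dim (res_map f) fullv.
by rewrite f0 capv0 dimv0 add0n => ->; rewrite -/(mdim N) MN.
Qed.

Lemma mdim_inj_lt M N (f : {linear M -> N}) :
  injective f -> ~ surjection f -> (mdim M < mdim N)%N.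
Proof.
move=> fi fns; rewrite ltn_neqAle (mdim_inj fi) andbT.
by apply/eqP => MN; apply/fns/(mdim_inj_surj fi).
Qed.

Lemma inj_surj_bij M N (f : {linear M -> N}) :
  injective f -> surjection f -> bijective f.
Proof.
move=> fi /choice [g gP]; exists g => // x.
by apply: fi; rewrite gP.
Qed.

Lemma endo_inj_bij M (f : {linear M -> M}) : injective f -> bijective f.
Proof. by move=> fi; apply: inj_surj_bij => //; apply: mdim_inj_surj. Qed.

Lemma endo_surj_bij M (f : {linear M -> M}) : surjection f -> bijective f.
Proof.
move=> fs; apply: inj_surj_bij (fs).
have f0 : lker (res_map f) == 0%VS.
  rewrite -dimv_eq0; move/res_map_limg: fs (limg_ker_dim (res_map f) fullv) => ->.
  by rewrite capfv => /eqP; rewrite -{2}[\dim fullv]add0n eqn_add2r.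
by move=> x y fxy; move/lker0P: f0; apply; rewrite !res_mapE.
Qed.

(** A subspace of largest dimension inside S is all of S. *)
Lemma vspace_of_pred (V : vectType F) (S : V -> Prop) :
  S 0 -> (forall c x y, S x -> S y -> S (c *: x + y)) ->
  exists U : {vspace V}, forall x, x \in U <-> S x.
Proof.
move=> S0 SP.
pose E n := `[< exists2 U : {vspace V}, \dim U = n & forall x, x \in U -> S x >].
have E0 : exists n, E n.
  exists 0%N; apply/asboolP; exists 0%VS; first exact: dimv0.
  by move=> x; rewrite memv0 => /eqP ->.
have Eb n : E n -> (n <= \dim {:V})%N.
  by move=> /asboolP [U <- _]; apply/dimvS/subvf.
have [n /asboolP [U Un US] n_max] := ex_maxnP E0 Eb.
exists U => x; split=> [|Sx]; first exact: US.
have /n_max : E (\dim (<[x]> + U)).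
  apply/asboolP; exists (<[x]> + U)%VS => // y.
  move=> /memv_addP [_ /vlineP [c ->] [u /US Su ->]].
  exact: SP.
rewrite -Un => le; have /eqP -> : U == (<[x]> + U)%VS by rewrite eqEdim addvSr.
by have := memv_add (memv_line x) (mem0v U); rewrite addr0.
Qed.

(** Submodules and quotients of M are both realised on a linear retract W of M, with
    i : W -> M and p : M -> W; the action is a . w = p (a *: i w).  It is
    associative when the image of i is stable (submodule) or the kernel of p is
    stable (quotient). *)
Section Retract.

Variables (M : fgmod A) (W : vectType F).
Variables (i : {linear W -> res M}) (p : {linear res M -> W}).
Hypothesis iK : cancel i p.

Definition retract_scale (a : oppring A) (w : W) : W := p (a *: (i w : M)).

Hypothesis retract_scaleA :
  forall a b w, retract_scale a (retract_scale b w) = retract_scale (a * b) w.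

(** The two proofs are arguments so that the module structure on W can be found
    from the type. *)
Definition retract_car of (cancel i p) &
  (forall a b w, retract_scale a (retract_scale b w) = retract_scale (a * b) w)
  : Type := W.

Local Notation V := (retract_car iK retract_scaleA).

HB.instance Definition _ := GRing.Zmodule.on V.

Fact retract_scale1 : left_id 1 retract_scale.
Proof. by move=> x; rewrite /retract_scale scale1r iK. Qed.

Fact retract_scaleDr : right_distributive retract_scale +%R.
Proof. by move=> a x y; rewrite /retract_scale linearD scalerDr linearD. Qed.

Fact retract_scaleDl w : {morph retract_scale^~ w : a b / a + b}.
Proof. by move=> a b; rewrite /retract_scale scalerDl linearD. Qed.

HB.instance Definition _ := GRing.Zmodule_isLmodule.Build (oppring A) V
  retract_scaleA retract_scale1 retract_scaleDr retract_scaleDl.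

Lemma retract_scaleF c (w : W) : retract_scale (base_scalar c) w = c *: w.
Proof. by rewrite /retract_scale -res_scaleE linearZ /= iK. Qed.

Lemma retract_fg : finitely_generated (V : lmodType (oppring A)).
Proof.
exists (\dim {:W}), (fun j => (vbasis {:W})`_j) => w.
exists (fun j => base_scalar (coord (vbasis {:W}) j w)).
rewrite [LHS](coord_vbasis (memvf (w : W))); apply: eq_bigr => j _.
by rewrite -retract_scaleF.
Qed.

Definition retract_mod : fgmod A := FGMod retract_fg.

End Retract.

Lemma submodule_exists M (S : M -> Prop) :
    S 0 -> (forall x y, S x -> S y -> S (x + y)) ->
    (forall a x, S x -> S (a *: x)) ->
  exists (N : fgmod A) (i : {linear N -> M}),
    injective i /\ forall x, S x <-> exists y, i y = x.
Proof.
move=> S0 SD SZ.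
have [U US] : exists U : {vspace res M}, forall x, x \in U <-> S x.
  by apply: vspace_of_pred => // c x y Sx Sy; apply: SD => //; apply: SZ.
pose i : {linear subvs_of U -> res M} := vsval.
pose p : {linear res M -> subvs_of U} := vsproj U.
have iK : cancel i p by apply: vsvalK.
have ip a (w : subvs_of U) : i (p (a *: (i w : M))) = a *: (i w : M).
  by apply: vsprojK; apply/US/SZ/US/subvsP.
have sA a b w : retract_scale i p a (retract_scale i p b w) = retract_scale i p (a * b) w.
  by rewrite /retract_scale ip scalerA.
have i_lin : linear (i : retract_mod iK sA -> M).
  by move=> a x y; rewrite linearD; congr (_ + _); apply: ip.
exists (retract_mod iK sA), (Lin i_lin); split; first exact: subvs_inj.
move=> x; split=> [/US xU|[y <-]]; first by exists (p x); exact: (vsprojK xU).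
exact/US/subvsP.
Qed.

(** The quotient lives on a complement of the submodule. *)
Lemma quotient_exists M (S : M -> Prop) :
    S 0 -> (forall x y, S x -> S y -> S (x + y)) ->
    (forall a x, S x -> S (a *: x)) ->
  exists (Q : fgmod A) (q : {linear M -> Q}),
    surjection q /\ forall x, S x <-> q x = 0.
Proof.
move=> S0 SD SZ.
have [U US] : exists U : {vspace res M}, forall x, x \in U <-> S x.
  by apply: vspace_of_pred => // c x y Sx Sy; apply: SD => //; apply: SZ.
pose i : {linear subvs_of U^C -> res M} := vsval.
have p_lin : linear (fun x : res M => vsproj U^C (x - projv U x)).
  move=> c x y; rewrite -linearP /= [projv U _]linearP scalerBr.
  by rewrite opprD addrACA.
pose p := Lin p_lin.
have p0 x : (p x = 0) <-> S x.
  split=> [px0|/US xU]; last by rewrite /p /= projv_id // subrr linear0.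
  apply/US; have : x - projv U x = 0.
    by rewrite -(vsprojK (memv_projC U x)) -[vsproj _ _]/(p x) px0.
  by move/eqP; rewrite subr_eq0 => /eqP ->; apply: memv_proj.
have iK : cancel i p.
  move=> w; rewrite /p /= (_ : projv U _ = 0) ?subr0 ?vsvalK //.
  by apply/eqP; rewrite -memv_ker lker_proj subvsP.
have pP a x y : p x = p y -> p (a *: (x : M)) = p (a *: (y : M)).
  move=> pxy; apply/eqP; rewrite -subr_eq0 -linearB; apply/eqP/p0.
  have /(SZ a) : S ((x : M) - (y : M)).
    by apply/p0; apply/eqP; rewrite [p _]linearB subr_eq0; apply/eqP.
  by rewrite scalerBr.
have sA a b w : retract_scale i p a (retract_scale i p b w) = retract_scale i p (a * b) w.
  by rewrite /retract_scale -scalerA; apply: pP; rewrite iK.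
have q_lin : linear (p : M -> retract_mod iK sA).
  by move=> a x y; rewrite linearD; congr (_ + _); apply: pP; rewrite iK.
exists (retract_mod iK sA), (Lin q_lin); split.
  by move=> y; exists (i y); apply: iK.
by move=> x; split=> /p0.
Qed.

End FinDim.

(** * Indecomposable modules and Gen-minimality *)

Section Indecomposables.

Variables (F : fieldType) (A : falgType F).
Implicit Types M N X Y K I : fgmod A.

Fact lin_scale_subproof M N (c : F) (f : {linear M -> N}) :
  linear (fun x => base_scalar A c *: f x).
Proof.
move=> a x y; rewrite linearP scalerDr; congr (_ + _).
by rewrite !scalerA base_scalar_central.
Qed.

Definition lin_scale M N c (f : {linear M -> N}) : {linear M -> N} :=
  Lin (lin_scale_subproof c f).

Lemma linear_injective M N (f : {linear M -> N}) :
  (forall x, f x = 0 -> x = 0) -> injective f.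
Proof.
move=> f0 x y fxy; apply/eqP; rewrite -subr_eq0; apply/eqP/f0.
by rewrite linearB fxy subrr.
Qed.

Lemma linear_lift M N X (i : {linear N -> M}) (f : {linear X -> M}) :
    injective i -> (forall x, exists y, i y = f x) ->
  exists g : {linear X -> N}, forall x, i (g x) = f x.
Proof.
move=> i_inj /choice [g gP].
have g_lin : linear g.
  by move=> a x y; apply: i_inj; rewrite linearP !gP linearP.
by exists (Lin g_lin).
Qed.

Lemma linear_factor M X Y (q : {linear M -> X}) (h : {linear M -> Y}) :
    surjection q -> (forall x, q x = 0 -> h x = 0) ->
  exists g : {linear X -> Y}, forall x, g (q x) = h x.
Proof.
move=> /choice [s sP] qh.
have hE x y : q x = q y -> h x = h y.
  move=> qxy; apply/eqP; rewrite -subr_eq0 -linearB; apply/eqP/qh.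
  by rewrite linearB qxy subrr.
have g_lin : linear (h \o s).
  by move=> a x y /=; rewrite -linearP; apply: hE; rewrite linearP !sP.
by exists (Lin g_lin) => x /=; apply: hE; rewrite sP.
Qed.

Lemma dsum_zero X Y : is_zero Y -> iso (dsum X Y) X.
Proof.
move=> Y0; exists (dsum_fst X Y); exists (dsum_inl X Y) => //.
by case=> x y; congr pair; rewrite [RHS]Y0.
Qed.

Lemma retract_split M X (p : {linear M -> X}) (s : {linear X -> M}) :
    cancel s p ->
  exists K (k : {linear K -> M}),
    (forall m, p m = 0 <-> exists y, k y = m) /\ iso M (dsum X K).
Proof.
move=> sK.
have [||a x px0|K [k [k_inj kP]]] := @submodule_exists F A M (fun m => p m = 0).
- exact: linear0.
- by move=> x y px0 py0; rewrite linearD px0 py0 addr0.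
- by rewrite linearZ /= px0 scaler0.
exists K, k; split=> //; apply: iso_sym.
pose f : {linear dsum X K -> M} :=
  (s \o dsum_fst X K) \+ (k \o dsum_snd X K).
have pk y : p (k y) = 0 by apply/kP; exists y.
exists f; apply: inj_surj_bij => [|m].
  apply: linear_injective => -[x y]; rewrite /f /= => sk0.
  have x0 : x = 0 by rewrite -(sK x) -[s x](addrK (k y)) sk0 sub0r linearN pk oppr0.
  move: sk0; rewrite x0 linear0 add0r => ky0; congr pair.
  by apply: k_inj; rewrite ky0 linear0.
have [|y ky] := (kP (m - s (p m))).1; first by rewrite linearB sK subrr.
by exists (p m, y); rewrite /f /= ky addrC subrK.
Qed.

Lemma mdim_dsuml M X Y : iso M (dsum X Y) -> ~ is_zero Y -> (mdim X < mdim M)%N.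
Proof.
move=> /iso_sym [f [g fK gK]] Yn0; apply: (@mdim_inj_lt _ _ _ _ (f \o dsum_inl X Y)).
  by move=> x y /= /(can_inj fK) [].
by move=> fs; apply: Yn0 => y; have [x /= /(can_inj fK) []] := fs (f (0, y)).
Qed.

Lemma dsumC X Y : iso (dsum X Y) (dsum Y X).
Proof.
pose f X Y : {linear dsum X Y -> dsum Y X} :=
  (dsum_inl Y X \o dsum_snd X Y) \+ (dsum_inr Y X \o dsum_fst X Y).
by exists (f X Y); exists (f Y X); case=> x y; congr pair; rewrite /= ?addr0 ?add0r.
Qed.

Lemma mdim_dsumr M X Y : iso M (dsum X Y) -> ~ is_zero X -> (mdim Y < mdim M)%N.
Proof. by move=> MXY; apply: mdim_dsuml (iso_trans MXY (dsumC X Y)). Qed.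

Fixpoint lpow M (f : {linear M -> M}) k : {linear M -> M} :=
  if k is k'.+1 then f \o lpow f k' else idfun.

Lemma lpowE M (f : {linear M -> M}) k x : lpow f k x = iter k f x.
Proof. by elim: k => //= k ->. Qed.

(** Take the power g of f whose image has the least dimension: the image of g o g is
    contained in that of g and cannot be smaller.  The exponent is kept positive so
    that f is injective when g is. *)
Lemma image_stabilizes M (f : {linear M -> M}) :
  exists k, forall x, exists y, iter k.+1 f x = iter k.+1 f (iter k.+1 f y).
Proof.
pose E n := `[< exists k, \dim (limg (res_map (lpow f k.+1))) = n >].
have E_ex : exists n, E n by eexists; apply/asboolP; exists 0%N.
have [n /asboolP [k kn] n_min] := ex_minnP E_ex; exists k => x.
have sub : (limg (res_map (lpow f (k.+1 + k.+1))) <= limg (res_map (lpow f k.+1)))%VS.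
  apply/subvP => _ /memv_imgP [y _ ->]; rewrite res_mapE lpowE iterD.
  by rewrite -lpowE -(res_mapE (lpow f k.+1)) memv_img ?memvf.
have /eqP im_eq : limg (res_map (lpow f (k.+1 + k.+1))) == limg (res_map (lpow f k.+1)).
  by rewrite eqEdim sub /= kn; apply: n_min; apply/asboolP; exists (k + k.+1)%N.
have : res_map (lpow f k.+1) x \in limg (res_map (lpow f k.+1)).
  by rewrite memv_img ?memvf.
rewrite -im_eq => /memv_imgP [y _]; rewrite !res_mapE !lpowE => xy.
by exists y; rewrite xy iterD.
Qed.

(** Once the images of the powers of f stabilise at g = f^(k+1), the submodule im g
    is a direct summand, with complement ker g; one of the two vanishes. *)
Lemma fitting X (f : {linear X -> X}) : indecomposable X ->
  bijective f \/ exists k, forall x, iter k f x = 0.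
Proof.
move=> [_ Xind]; have [k kP] := image_stabilizes f.
pose g := lpow f k.+1.
have [||a _ [x <-]|I [i [i_inj iP]]] :=
    @submodule_exists F A X (fun m => exists x, g x = m).
- by exists 0; apply: linear0.
- by move=> _ _ [x <-] [y <-]; exists (x + y); apply: linearD.
- by exists (a *: x); apply: linearZ.
have [|q qP] := @linear_lift _ _ _ i g i_inj; first by move=> x; apply/iP; exists x.
have : surjection (q \o i : {linear I -> I}).
  move=> y; have [x xy] : exists x, g x = i y by apply/iP; exists y.
  have [x' x'P] := kP x; exists (q x'); apply: i_inj; rewrite qP.
  by rewrite /= qP -xy /g !lpowE x'P.
move/endo_surj_bij/linear_inverse => [u [uK _]].
have [K [m [mP XIK]]] := @retract_split X I (u \o q) i uK.
have [I0|K0] := Xind _ _ XIK; [right|left].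
  by exists k.+1 => x; rewrite -lpowE -/g -qP [q x]I0 linear0.
apply: endo_inj_bij; apply: linear_injective => x fx0.
have [|y <-] := (mP x).1; last by rewrite [y]K0 linear0.
rewrite /= [X in u X](_ : q x = 0) ?linear0 //.
by apply: i_inj; rewrite qP /g lpowE iterSr fx0 -lpowE !linear0.
Qed.

(** If f is nilpotent, then g = 1 - f is injective: it can only kill a fixed point of
    f, and these are 0. *)
Lemma local_end X (f g : {linear X -> X}) : indecomposable X ->
  (forall x, f x + g x = x) -> bijective f \/ bijective g.
Proof.
move=> Xind fg; have [|[k kP]] := fitting f Xind; first by left.
right; apply: endo_inj_bij; apply: linear_injective => x gx0.
by rewrite -(kP x); elim: k {kP} => //= k <-; rewrite -{1}(fg x) gx0 addr0.
Qed.

(** If u = f + g had an inverse v, then f o v + g o v would be the identity. *)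
Lemma nonbij_add X (f g u : {linear X -> X}) : indecomposable X ->
  (forall x, u x = f x + g x) -> ~ bijective f -> ~ bijective g -> ~ bijective u.
Proof.
move=> Xind ufg fn gn /linear_inverse [v [vK Kv]].
have key (h : {linear X -> X}) : bijective (h \o v : {linear X -> X}) -> bijective h.
  move/bij_inj => hv; apply: endo_inj_bij => x y hxy.
  by apply: (can_inj vK); apply: hv; rewrite /= !vK.
have [x|/key|/key] // := @local_end X (f \o v) (g \o v) Xind.
by rewrite /= -ufg Kv.
Qed.

Lemma nonbij_comp X (f g : {linear X -> X}) :
  ~ bijective f -> ~ bijective (f \o g : {linear X -> X}).
Proof.
move=> fn [h _ hK]; apply/fn/endo_surj_bij => x.
by exists (g (h x)); apply: hK.
Qed.

Lemma nonbij0 X : indecomposable X -> ~ bijective (\0 : {linear X -> X}).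
Proof. by move=> [Xn0 _] [g gK _]; apply: Xn0 => x; rewrite -(gK x) -(gK 0). Qed.

Lemma sum_id_bij X (J : finType) (f : J -> {linear X -> X}) :
  indecomposable X -> (forall x, x = \sum_i f i x) -> exists i, bijective (f i).
Proof.
move=> Xind sumf; apply: contrapT => nb.
have {}nb i : ~ bijective (f i) by move=> fb; apply: nb; exists i.
have nb_sum (r : seq J) : ~ bijective (Lin (lin_sum_subproof r f)).
  elim: r => [/bij_inj sum_inj|i r IHr].
    by have [Xn0 _] := Xind; apply: Xn0 => x; apply: sum_inj; rewrite /= !big_nil.
  apply: nonbij_add (nb i) IHr => // x; exact: big_cons.
by apply: (nb_sum (index_enum J)); exists id => x /=; rewrite -sumf.
Qed.

Lemma indecomposable_retract X Y (a : {linear Y -> X}) (b : {linear X -> Y}) :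
    indecomposable X -> ~ is_zero Y -> bijective (b \o a : {linear Y -> Y}) ->
  iso Y X.
Proof.
move=> [_ Xind] Yn0 /linear_inverse [v [vK _]].
have [K [_ [_ XYK]]] := @retract_split X Y (v \o b) a vK.
have [//|K0] := Xind _ _ XYK.
by apply: iso_sym; apply: iso_trans XYK (dsum_zero _ K0).
Qed.

(** T plus the images of the non-invertible endomorphisms, that is, T + rad(End X) X
    when End X is local. *)
Inductive rad_span X (T : X -> Prop) : X -> Prop :=
  | rad_span_base x : T x -> rad_span T x
  | rad_span_img (e : {linear X -> X}) x : ~ bijective e -> rad_span T (e x)
  | rad_span_add x y : rad_span T x -> rad_span T y -> rad_span T (x + y).

(** T plus the combinations of the elements of s with coefficients endomorphisms
    satisfying P; both P = everything and P = non-invertible are needed. *)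
Fixpoint lin_span X (T : X -> Prop) (P : {linear X -> X} -> Prop)
    (s : seq (res X)) (y : X) : Prop :=
  if s is z :: s' then exists e, P e /\ lin_span T P s' (y - e z) else T y.

Section Nakayama.

Variables (X : fgmod A) (T : X -> Prop).
Hypothesis T0 : T 0.
Hypothesis TD : forall x y, T x -> T y -> T (x + y).
Hypothesis TE : forall (e : {linear X -> X}) x, T x -> T (e x).

Implicit Types (P Q : {linear X -> X} -> Prop) (s : seq (res X)).

Lemma lin_span_base P s x : P \0 -> T x -> lin_span T P s x.
Proof.
move=> P0; elim: s x => //= z s IHs x Tx; exists \0; rewrite subr0.
by split; last exact: IHs.
Qed.

Lemma lin_spanD P s x y : (forall e f, P e -> P f -> P (e \+ f)) ->
  lin_span T P s x -> lin_span T P s y -> lin_span T P s (x + y).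
Proof.
move=> PD; elim: s x y => [|z s IHs] x y /=; first exact: TD.
move=> [e [Pe ex]] [f [Pf fy]]; exists (e \+ f); split; first exact: PD.
by rewrite /= opprD addrACA; apply: IHs.
Qed.

Lemma lin_span_map P Q (u : {linear X -> X}) s x :
    (forall e, P e -> Q (u \o e)) ->
  lin_span T P s x -> lin_span T Q s (u x).
Proof.
move=> PQ; elim: s x => [|z s IHs] x /=; first exact: TE.
by move=> [e [/PQ Qe /IHs ex]]; exists (u \o e); rewrite /= -linearB.
Qed.

(** Nakayama's lemma for the End X-module X: elements are removed one at a time from a
    family that spans X modulo T, starting from a basis over the base field.  If z :: s
    spans, then z = e z + (terms in s) modulo T with e non-invertible, and since 1 - e
    is invertible, z already lies in the span of s. *)
Lemma nakayama :
  indecomposable X -> (forall x, rad_span T x) -> forall x, T x.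
Proof.
move=> Xind radX.
pose all_end := fun _ : {linear X -> X} => True.
pose nonbij := fun e : {linear X -> X} => ~ bijective e.
have nb0 : nonbij \0 by apply: nonbij0.
have nbD e f : nonbij e -> nonbij f -> nonbij (e \+ f).
  by move=> en fn; apply: nonbij_add en fn.
have rad_s s : (forall x, lin_span T all_end s x) -> forall x, lin_span T nonbij s x.
  move=> sX x; elim: (radX x) => {x} [x Tx|e x en|x y _ IHx _ IHy].
  - exact: lin_span_base.
  - by apply: (@lin_span_map all_end) (sX x) => f _; apply: nonbij_comp.
  - exact: lin_spanD.
have descend s : (forall x, lin_span T all_end s x) -> forall x, T x.
  elim: s => //= z s IHs sX; apply: IHs => x.
  have [e [en zs]] := rad_s (z :: s) sX z.
  have [|//|/linear_inverse [v [vK _]]] := @local_end X e (idfun \- e) Xind.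
    by move=> y /=; rewrite addrC subrK.
  have {}zs : lin_span T all_end s z.
    by rewrite -(vK z); apply: lin_span_map zs.
  have [f [_ fx]] := sX x; rewrite -(subrK (f z) x).
  by apply: lin_spanD => //; apply: lin_span_map zs.
apply: (descend (vbasis {: res X})) => x.
have : (x : res X) \in <<vbasis {: res X}>>%VS.
  by rewrite (span_basis (vbasisP _)) memvf.
elim: (tval _) x => [|z s IHs] x /=; first by rewrite span_nil memv0 => /eqP ->.
rewrite span_cons => /memv_addP [_ /vlineP [c ->] [y ys ->]].
exists (lin_scale c idfun); split=> //.
have -> : (c *: z + y : X) - lin_scale c idfun z = y.
  by change (c *: z + y - c *: z = y); rewrite addrC addKr.
exact: IHs.
Qed.

End Nakayama.

(** If f : Y -> X does not split, no f o h with h : X -> Y is bijective, so the part of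
    Y generated by X only reaches rad(End X) X; the rest comes from M'. *)
Lemma Gen_summand_splitting X M M' : indecomposable X ->
  iso M (dsum X M') -> ~ Gen M' X -> splitting_projective (Gen M) X.
Proof.
move=> Xind MX nX; split=> // [|Y f MY fs].
  by apply: Gen_summand (Gen_iso MX (Gen_refl M)).
have /GenP {}MY : Gen (dsum X M') Y by apply/(Gen_iso_same MX).
apply: contrapT => nsplit; apply/nX/GenP.
apply: nakayama => //; [exact: trace0|exact: trace_add|by move=> e x; apply: trace_map|].
move=> x; have [y <-] := fs x.
elim: (MY y) => {x y} [h z|y1 y2 _ IH1 _ IH2]; last first.
  by rewrite linearD; apply: rad_span_add.
rewrite [z]dsum_split !linearD; apply: rad_span_add; last first.
  by apply: rad_span_base; apply: (trace_img (f \o (h \o dsum_inr X M'))).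
apply: (@rad_span_img _ _ (f \o (h \o dsum_inl X M'))) => /linear_inverse [v [_ vK]].
by apply: nsplit; exists ((h \o dsum_inl X M') \o v).
Qed.

(** A surjection onto Y from a power of M splits, so the identity of Y is a sum of
    endomorphisms each of which factors through some X j. *)
Lemma splitting_projective_is_summand (J : finType) (X : J -> fgmod A) M Y :
    (forall j, indecomposable (X j)) -> is_dsum X M ->
  splitting_projective (Gen M) Y -> exists j, iso Y (X j).
Proof.
move=> Xind XM [Yind [n [f fs]] Ysp].
have nM := is_dsum_fam (fun _ : 'I_n => M).
have [g fg] := Ysp _ f (Gen_dsum_of nM (fun _ => Gen_refl M)) fs.
have [inj [pr [_ _ sE]]] := nM; have [inj' [pr' [_ _ sE']]] := XM.
have [|[k j] bkj] := @sum_id_bij Y ('I_n * J)%type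
  (fun p => (f \o (inj p.1 \o inj' p.2)) \o (pr' p.2 \o (pr p.1 \o g))) Yind.
  move=> y.
  rewrite -(pair_bigA _ (fun k j => f (inj k (inj' j (pr' j (pr k (g y))))))) /=.
  rewrite -{1}(fg y) {1}[g y]sE linear_sum; apply: eq_bigr => k _.
  by rewrite {1}[pr k (g y)]sE' !linear_sum.
by exists j; apply: indecomposable_retract bkj => //; have [] := Yind.
Qed.

Lemma dsum_complement (J : finType) (X : J -> fgmod A) M j : is_dsum X M ->
  exists M', iso M (dsum (X j) M') /\ forall i, i != j -> Gen M' (X i).
Proof.
move=> [inj [pr [pK p0 _]]].
have [K [k [kP MK]]] := retract_split (pK j); exists K; split=> // i ij.
apply: (Gen_quotient_closed (f := pr i \o k) _ (Gen_refl K)) => x.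
by have [y ky] := (kP (inj i x)).1 (p0 _ _ _ ij); exists y; rewrite /= ky pK.
Qed.

Lemma Gen_minimal_splitting_projective_sum M :
  Gen_minimal M -> splitting_projective_sum (Gen M) M.
Proof.
move=> [[n [X [Xind Xni MX]]] M_min]; exists n, X; have XM := (iso_dsum_famP X M).1 MX.
split=> // [i|Y]; last exact: splitting_projective_is_summand.
have [M' [MM' _]] := dsum_complement i XM.
by apply: Gen_summand_splitting MM' (M_min _ _ MM' _).
Qed.

Lemma decomposition M : exists (J : finType) (X : J -> fgmod A),
  (forall j, indecomposable (X j)) /\ is_dsum X M.
Proof.
have [n] := ubnP (mdim M); elim: n M => // n IHn M /ltnSE Mn.
have [M0|Mn0] := pselect (is_zero M).
  exists void, (of_void _); split; first by case.
  by apply: is_dsum0 M0; rewrite card_void.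
have [Mind|Mdec] := pselect (indecomposable M).
  by exists unit, (fun=> M); split=> //; apply: is_dsum1.
have [X [Y [MXY Xn0 Yn0]]] : exists X Y, [/\ iso M (dsum X Y), ~ is_zero X & ~ is_zero Y].
  apply: contrapT => ndec; apply: Mdec; split=> // X Y MXY.
  apply: contrapT => /not_orP [Xn0 Yn0]; apply: ndec; by exists X, Y.
have [I [XI [XIind XIX]]] := IHn X (leq_trans (mdim_dsuml MXY Yn0) Mn).
have [J [YJ [YJind YJY]]] := IHn Y (leq_trans (mdim_dsumr MXY Xn0) Mn).
exists (I + J)%type, (fun k => match k with inl i => XI i | inr j => YJ j end).
split; first by case.
by apply: is_dsum_isoS (iso_sym MXY) _; apply: is_dsum_sum.
Qed.

(** A module of least dimension among those generating the same subcategory has no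
    nonzero summand generated by its complement.  This also excludes two isomorphic
    summands in its decomposition. *)
Lemma Gen_minimal_exists N : exists M, Gen_minimal M /\ same_subcat (Gen M) (Gen N).
Proof.
pose E n := `[< exists M, [/\ mdim M = n, Gen M N & Gen N M] >].
have E_ex : exists n, E n.
  by exists (mdim N); apply/asboolP; exists N; split=> //; apply: Gen_refl.
have [_ /asboolP [M [<- MN NM]] n_min] := ex_minnP E_ex.
have M_min X M' : iso M (dsum X M') -> ~ is_zero X -> ~ Gen M' X.
  move=> MX Xn0 M'X.
  have M'M : Gen M' M by apply: Gen_iso (iso_sym MX) (Gen_dsum M'X (Gen_refl M')).
  have MM' : Gen M M' by apply: Gen_summandr (Gen_iso MX (Gen_refl M)).
  have /n_min : E (mdim M').
    by apply/asboolP; exists M'; split=> //; [apply: Gen_trans MN|apply: Gen_trans MM'].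
  by rewrite leqNgt (mdim_dsumr MX Xn0).
exists M; split; last exact: same_Gen.
split; last by move=> X M' MX [Xn0 _]; apply: M_min MX Xn0.
have [J [X [Xind XM]]] := decomposition M.
exists #|J|, (X \o @enum_val J J); split=> [k|k l kl|]; first exact: Xind.
  have [M' [MM' M'X]] := dsum_complement (enum_val k) XM.
  have [Xn0 _] := Xind (enum_val k).
  move=> /= /iso_sym Xkl; apply: (M_min _ _ MM' Xn0); apply: Gen_iso Xkl (M'X _ _).
  by apply/eqP => /enum_val_inj lk; apply: kl.
apply/iso_dsum_famP/is_dsum_reindex => //; exact: enum_val_bij.
Qed.

End Indecomposables.

(** * Approximations *)

Section Approximations.

Variables (F : fieldType) (A : falgType F).
Implicit Types (M N X Y Q U : fgmod A) (C : fgmod A -> Prop).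

(** The inclusion of the trace of M in X is a right approximation. *)
Lemma Gen_contravariantly_finite M : contravariantly_finite (Gen M).
Proof.
move=> X.
have [|||N [i [i_inj iP]]] := @submodule_exists F A X (@in_trace _ M X).
- exact: trace0.
- exact: trace_add.
- exact: trace_scale.
have lift (Z : fgmod A) (g : {linear Z -> X}) : (forall z, in_trace M (g z)) ->
    exists h : {linear Z -> N}, forall z, i (h z) = g z.
  by move=> gM; apply: linear_lift => // z; apply/iP.
exists N, i; split=> [|Y g /GenP MY]; last first.
  by have [y|h hP] := lift Y g; [apply: trace_map|exists h].
apply/GenP => y; have : in_trace M (i y) by apply/iP; exists y.
suff /[apply] : forall x, in_trace M x -> exists2 y', i y' = x & in_trace M y'.
  by case=> y' /i_inj ->.
move=> x; elim=> {x y} [f m|_ _ _ [y1 <- My1] _ [y2 <- My2]].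
  have [m'|h hP] := lift M f; first exact: trace_img.
  by exists (h m); [apply: hP|apply: trace_img].
by exists (y1 + y2); [apply: linearD|apply: trace_add].
Qed.

(** Constant multiples of a morphism are morphisms, so the coordinates of an element
    of M can be moved into the morphisms.  The elements of M that occur are thus the
    same for all y and N, as a left approximation requires. *)
Lemma trace_basis M N (y : N) : in_trace M y ->
  exists h : 'I_(\dim {: res M}) -> {linear M -> N},
    y = \sum_j h j ((vbasis {: res M})`_j : M).
Proof.
elim=> [f m|_ _ _ [h1 ->] _ [h2 ->]]; last first.
  by exists (fun j => h1 j \+ h2 j); rewrite -big_split.
exists (fun j => lin_scale (coord (vbasis {: res M}) j (m : res M)) f).
rewrite {1}[m](coord_vbasis (memvf (m : res M))) linear_sum.
by apply: eq_bigr => j _; rewrite /= res_scaleE linearZ.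
Qed.

(** A morphism from X to a module of Gen M is determined by the images of the
    generators x_i, and trace_basis writes these as values at the fixed elements u_i
    of a power U of M.  So X maps to the quotient of U that makes x_i |-> u_i well
    defined, and every such morphism factors through it. *)
Lemma Gen_covariantly_finite M : covariantly_finite (Gen M).
Proof.
move=> X; have [n [x xP]] := fgmod_fg X.
pose d := \dim {: res M}; pose m (j : 'I_d) : M := (vbasis {: res M})`_j.
have [U MU] := dsum_exists (fun _ : 'I_n * 'I_d => M).
have [inj [pr [pK p0 _]]] := MU.
pose u i := \sum_j inj (i, j) (m j).
pose rel v := exists2 a : 'I_n -> oppring A,
  \sum_i a i *: x i = 0 & v = \sum_i a i *: u i.
have [|||Q [q [qs qP]]] := @quotient_exists F A U rel.
- by exists (fun=> 0); rewrite big1 // => i _; rewrite scale0r.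
- move=> _ _ [a ax0 ->] [b bx0 ->]; exists (fun i => a i + b i).
    under eq_bigr => i _ do rewrite scalerDl.
    by rewrite big_split /= ax0 bx0 addr0.
  by rewrite -big_split; apply: eq_bigr => i _; rewrite scalerDl.
- move=> c _ [a ax0 ->]; exists (fun i => c * a i).
    under eq_bigr => i _ do rewrite -scalerA.
    by rewrite -scaler_sumr ax0 scaler0.
  by rewrite scaler_sumr; apply: eq_bigr => i _; rewrite scalerA.
have [a aP] := choice xP.
pose phi y := q (\sum_i a y i *: u i).
(* Any expression of y in the generators may be used to compute phi y. *)
have phiE (b : 'I_n -> oppring A) y :
    y = \sum_i b i *: x i -> phi y = q (\sum_i b i *: u i).
  move=> yb; apply/eqP; rewrite -subr_eq0 -linearB; apply/eqP/qP.
  exists (fun i => a y i - b i).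
    under eq_bigr => i _ do rewrite scalerBl.
    by rewrite sumrB -aP -yb subrr.
  by rewrite -sumrB; apply: eq_bigr => i _; rewrite scalerBl.
have phi_lin : linear phi.
  move=> c y z; rewrite (phiE (fun i => c * a y i + a z i)).
    rewrite -linearP; congr (q _); rewrite scaler_sumr -big_split.
    by apply: eq_bigr => i _; rewrite scalerDl scalerA.
  rewrite {1}[y]aP {1}[z]aP scaler_sumr -big_split.
  by apply: eq_bigr => i _; rewrite scalerDl scalerA.
exists Q, (Lin phi_lin); split=> [|Y g /GenP MY].
  exact: (Gen_quotient_closed qs) (Gen_dsum_of MU (fun _ => Gen_refl M)).
have /choice [h hP] i := trace_basis (MY (g (x i))).
pose H := lin_sum (fun p : 'I_n * 'I_d => h p.1 p.2 \o pr p).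
have Hu i : H (u i) = g (x i).
  rewrite hP /u linear_sum; apply: eq_bigr => j _.
  rewrite /H /= (bigD1 (i, j)) //= pK big1 ?addr0 // => p pij.
  by rewrite p0 ?linear0 // eq_sym.
have Hsum (b : 'I_n -> oppring A) : H (\sum_i b i *: u i) = g (\sum_i b i *: x i).
  by rewrite !linear_sum; apply: eq_bigr => i _; rewrite !linearZ Hu.
have [|k kP] := linear_factor (h := H) qs.
  by move=> _ /qP [b bx0 ->]; rewrite Hsum bx0 linear0.
by exists k => y; rewrite /= /phi kP Hsum -aP.
Qed.

Lemma Gen_ff_quotient_closed M : ff_quotient_closed_subcat (Gen M).
Proof.
split; [exact: Gen_subcategory|split|exact: Gen_quotient_closed].
  exact: Gen_contravariantly_finite.
exact: Gen_covariantly_finite.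
Qed.

Lemma regular_fg : finitely_generated ((oppring A)^o : lmodType (oppring A)).
Proof.
by exists 1%N, (fun=> 1) => x; exists (fun=> x); rewrite big_ord1 [RHS]mulr1.
Qed.

Definition regular_mod : fgmod A := FGMod regular_fg.

(** The map a |-> x.a from the regular module reaches any chosen x in X; it factors
    through the approximation N, so x lies in the trace of N. *)
Lemma covariantly_finite_Gen C :
    subcategory C -> quotient_closed C -> covariantly_finite C ->
  exists N, same_subcat (Gen N) C.
Proof.
move=> subC quoC covC; have [N [f [CN fP]]] := covC regular_mod; exists N => X.
have CNn n : C (dsum_fam (fun _ : 'I_n => N)).
  rewrite /dsum_fam; elim/big_ind: _ => //.
    exact: subcat_zero subC.
  by move=> ? ?; apply: subcat_dsum subC _ _.
split=> [[n [g gs]]|CX]; first exact: quoC gs (CNn n).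
apply/GenP => x.
have x_lin : linear (fun a : regular_mod => (a : oppring A) *: x).
  by move=> a b c; rewrite scalerDl scalerA.
have [h hP] := fP X (Lin x_lin) CX.
by rewrite -[x]scale1r -[_ *: x]/(Lin x_lin (1 : oppring A)) hP; apply: trace_img.
Qed.

End Approximations.

(** * The bijection *)

Theorem theorem3 (F : fieldType) (A : falgType F) :
  [/\ (* M |-> Gen M is well defined on isomorphism classes ... *)
      forall M N : fgmod A, iso M N ->
        (Gen_minimal M <-> Gen_minimal N) /\ same_subcat (Gen M) (Gen N),
      (* ... with values in the stated set of subcategories, *)
      forall M : fgmod A, Gen_minimal M -> ff_quotient_closed_subcat (Gen M),
      (* injective, *)
      forall M N : fgmod A, Gen_minimal M -> Gen_minimal N ->
        same_subcat (Gen M) (Gen N) -> iso M N,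
      (* surjective, *)
      forall C : fgmod A -> Prop, ff_quotient_closed_subcat C ->
        exists M : fgmod A, Gen_minimal M /\ same_subcat (Gen M) C
    & (* and its inverse is the sum of the splitting projectives. *)
      [/\ forall C : fgmod A -> Prop, ff_quotient_closed_subcat C ->
            exists P : fgmod A, splitting_projective_sum C P,
          forall (C : fgmod A -> Prop) (P : fgmod A),
            ff_quotient_closed_subcat C -> splitting_projective_sum C P ->
            Gen_minimal P /\ same_subcat (Gen P) C
        & forall M P : fgmod A, Gen_minimal M ->
            splitting_projective_sum (Gen M) P -> iso P M]].
Proof.
have Gen_minimal_for C : ff_quotient_closed_subcat C ->
    exists M : fgmod A, Gen_minimal M /\ same_subcat (Gen M) C.
  move=> [subC [_ covC] quoC]; have [N NC] := covariantly_finite_Gen subC quoC covC.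
  have [M [M_min MN]] := Gen_minimal_exists N.
  by exists M; split=> // X; split=> [/MN /NC|/NC /MN].
have sps_for C : ff_quotient_closed_subcat C -> exists M : fgmod A,
    [/\ Gen_minimal M, same_subcat (Gen M) C & splitting_projective_sum C M].
  move=> /Gen_minimal_for [M [M_min MC]]; exists M; split=> //.
  exact: splitting_projective_sum_same MC (Gen_minimal_splitting_projective_sum M_min).
split=> //.
- move=> M N MN; split; last exact: Gen_iso_same.
  by split; apply: Gen_minimal_iso => //; apply: iso_sym.
- by move=> M _; apply: Gen_ff_quotient_closed.
- move=> M N /Gen_minimal_splitting_projective_sum spM.
  move=> /Gen_minimal_splitting_projective_sum spN MN.
  exact: splitting_projective_sum_iso (splitting_projective_sum_same MN spM) spN.
split.
- by move=> C /sps_for [M [_ _ spM]]; exists M.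
- move=> C P /sps_for [M [M_min MC spM]] spP.
  have MP := splitting_projective_sum_iso spM spP.
  split; first exact: Gen_minimal_iso M_min.
  by move=> X; split=> [/(Gen_iso_same MP) /MC|/MC /(Gen_iso_same MP)].
- move=> M P /Gen_minimal_splitting_projective_sum spM spP.
  exact: splitting_projective_sum_iso spP spM.
Qed.
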